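(* Let $\mathcal{X}$ be a complex Banach space with $\dim \mathcal{X}\geq 2$, let $\mathcal{U}\subseteq B(\mathcal{X})$ be a unital standard operator algebra (that is, one containing the identity operator $I$), let $n\geq 2$ be a fixed integer, and let $\phi:\mathcal{U}\rightarrow\mathcal{U}$ be a linear mapping which is continuous under the strong operator topology. The following are equivalent: (i) $\phi$ is a Lie $n$-centralizer; (ii) $\phi$ satisfies $\mathbf{(N)}$; (iii) $\phi$ satisfies $\mathbf{(N_l)}$; (iv) $\phi$ satisfies $\mathbf{(N_r)}$; (v) $\phi$ satisfies $\mathbf{(T)}$; (vi) $\phi$ satisfies $\mathbf{(T_l)}$; (vii) $\phi$ satisfies $\mathbf{(T_r)}$; (viii) there exist an element $\lambda\in\mathbb{C}$ and a linear map $\mu:\mathcal{U}\rightarrow\mathbb{C}$ such that $\phi(A)=\lambda A+\mu(A)I$ for all $A\in\mathcal{U}$ and $\mu(p_n(A_1,A_2,\dots,A_n))=0$ for all $A_1,A_2,\dots,A_n\in\mathcal{U}$.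
   Context: All algebras and vector spaces are over $\mathbb{C}$. For a complex Banach space $\mathcal{X}$, $B(\mathcal{X})$ is the algebra of all bounded linear operators on $\mathcal{X}$ and $F(\mathcal{X})$ is its ideal of finite rank operators. A standard operator algebra over $\mathcal{X}$ is any subalgebra of $B(\mathcal{X})$ containing $F(\mathcal{X})$ (no closedness is assumed). Continuity under the strong operator topology means continuity when both the domain and codomain copies of $\mathcal{U}$ carry the (relative) strong operator topology of $B(\mathcal{X})$. For elements of an algebra $\mathcal{U}$, $[a,b]=ab-ba$, and $p_n$ is defined recursively by $p_1(a_1)=a_1$ and $p_n(a_1,\dots,a_n)=[p_{n-1}(a_1,\dots,a_{n-1}),a_n]$ for $n\geq 2$. A linear map $\phi:\mathcal{U}\to\mathcal{U}$ is a Lie $n$-centralizer ($n\geq2$) if $\phi(p_n(a_1,a_2,\dots,a_n))=p_n(\phi(a_1),a_2,\dots,a_n)$ for all $a_1,\dots,a_n\in\mathcal{U}$. For a fixed integer $n\geq 2$ and a linear map $\phi:\mathcal{U}\to\mathcal{U}$, consider the following conditions: - $\mathbf{(T_l)}$: $\phi(p_n(a_1,a_2,\dots,a_n))=p_n(\phi(a_1),a_2,\dots,a_n)$ for all $a_1,\dots,a_n\in\mathcal{U}$ with $a_1a_2=0$. - $\mathbf{(T_r)}$: $\phi(p_n(a_1,a_2,\dots,a_n))=p_n(a_1,\phi(a_2),a_3,\dots,a_n)$ for all $a_1,\dots,a_n\in\mathcal{U}$ with $a_1a_2=0$. - $\mathbf{(T)}$: both $\mathbf{(T_l)}$ and $\mathbf{(T_r)}$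 hold. - $\mathbf{(N_l)}$: $\phi(p_n(a_1,a_2,\dots,a_n))=p_n(\phi(a_1),a_2,\dots,a_n)$ for all $a_1,\dots,a_n\in\mathcal{U}$ with $a_1a_2\cdots a_n=0$. - $\mathbf{(N_r)}$: $\phi(p_n(a_1,a_2,\dots,a_n))=p_n(a_1,\phi(a_2),a_3,\dots,a_n)$ for all $a_1,\dots,a_n\in\mathcal{U}$ with $a_1a_2\cdots a_n=0$. - $\mathbf{(N)}$: both $\mathbf{(N_l)}$ and $\mathbf{(N_r)}$ hold. *)

(* Defs.v *)
From HB Require Import structures.
From mathcomp Require Import all_boot all_order all_algebra.
From mathcomp Require Import all_classical all_reals all_analysis.

Set Implicit Arguments.
Unset Strict Implicit.
Unset Printing Implicit Defensive.

Import Order.TTheory GRing.Theory Num.Theory.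
Import numFieldNormedType.Exports.

Local Open Scope classical_set_scope.
Local Open Scope ring_scope.

Section LieCentralizers.
Variable A : pzRingType.
Implicit Types (a b : A) (s : seq A) (phi : A -> A).

Definition lie_bracket a b : A := a * b - b * a.

(* lie_comm [:: a_1; ...; a_n] is p_n(a_1, ..., a_n); the value on the empty
   sequence is irrelevant. *)
Definition lie_comm s : A := if s is a :: s' then foldl lie_bracket a s' else 0.

Lemma lie_comm1 a : lie_comm [:: a] = a. Proof. by []. Qed.

Lemma lie_comm_rcons s b : s != [::] ->
  lie_comm (rcons s b) = lie_bracket (lie_comm s) b.
Proof. by case: s => //= a s _; rewrite foldl_rcons. Qed.

Definition lie_centralizer (n : nat) phi := forall a (s : n.-1.-tuple A),
  phi (lie_comm (a :: s)) = lie_comm (phi a :: s).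

(* In the conditions below n >= 2 and (a_1, ..., a_n) is split as a_1, a_2 and
   the tuple s = (a_3, ..., a_n). *)
Definition cond_Tl (n : nat) phi := forall a1 a2 (s : n.-2.-tuple A),
  a1 * a2 = 0 ->
  phi (lie_comm [:: a1, a2 & s]) = lie_comm [:: phi a1, a2 & s].

Definition cond_Tr (n : nat) phi := forall a1 a2 (s : n.-2.-tuple A),
  a1 * a2 = 0 ->
  phi (lie_comm [:: a1, a2 & s]) = lie_comm [:: a1, phi a2 & s].

Definition cond_T n phi := cond_Tl n phi /\ cond_Tr n phi.

Definition cond_Nl (n : nat) phi := forall a1 a2 (s : n.-2.-tuple A),
  \prod_(a <- [:: a1, a2 & s]) a = 0 ->
  phi (lie_comm [:: a1, a2 & s]) = lie_comm [:: phi a1, a2 & s].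

Definition cond_Nr (n : nat) phi := forall a1 a2 (s : n.-2.-tuple A),
  \prod_(a <- [:: a1, a2 & s]) a = 0 ->
  phi (lie_comm [:: a1, a2 & s]) = lie_comm [:: a1, phi a2 & s].

Definition cond_N n phi := cond_Nl n phi /\ cond_Nr n phi.

End LieCentralizers.

Section LinearAlgebra.
Variables (K : numFieldType) (V : lmodType K).

Definition lin_independent m (v : 'I_m -> V) :=
  forall c : 'I_m -> K, \sum_i c i *: v i = 0 -> forall i, c i = 0.

Definition dim_ge m := exists v : 'I_m -> V, lin_independent v.

Definition lin_span m (v : 'I_m -> V) : set V :=
  [set \sum_i c i *: v i | c in [set: 'I_m -> K]].

End LinearAlgebra.

Section BoundedOperators.
Variables (K : numFieldType) (X : normedModType K).

Definition bounded_linear : {pred X -> X} := fun f =>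
  `[< linear f /\ exists2 M : K, 0 <= M & forall x, `|f x| <= M * `|x| >].

Lemma bounded_linearP f : reflect
  (linear f /\ exists2 M : K, 0 <= M & forall x, `|f x| <= M * `|x|)
  (f \in bounded_linear).
Proof. exact: asboolP. Qed.

(* The algebra B(X), with composition as product. It is a ring and a K-module,
   but not an algType in general: that structure requires 1 != 0, which fails
   when X is trivial. *)
Record bop := Bop { bop_fun :> X -> X; _ : bop_fun \in bounded_linear }.

HB.instance Definition _ := [isSub for bop_fun].
HB.instance Definition _ := [Choice of bop by <:].

Fact bounded_linear_submod : submod_closed bounded_linear.
Proof.
split=> [|k f g /bounded_linearP[lf [M M0 fM]] /bounded_linearP[lg [N N0 gN]]].
  have E x : (0 : X -> X) x = 0 by [].
  apply/bounded_linearP; split=> [a u v|]; first by rewrite !E scaler0 addr0.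
  by exists 0 => // x; rewrite mul0r E normr0.
have E x : (k *: f + g) x = k *: f x + g x by [].
apply/bounded_linearP; split=> [a u v|].
  by rewrite !E lf lg !scalerDr !scalerA addrACA [k * a]mulrC.
exists (`|k| * M + N); first by rewrite addr_ge0// mulr_ge0.
move=> x; rewrite E (le_trans (ler_normD _ _))// mulrDl lerD//.
by rewrite normrZ -mulrA ler_wpM2l.
Qed.
HB.instance Definition _ :=
  GRing.isSubmodClosed.Build K (X -> X) bounded_linear bounded_linear_submod.
HB.instance Definition _ := [SubChoice_isSubLmodule of bop by <:].

Fact bop_linear (A : bop) : linear A.
Proof. by case: A => f /= /bounded_linearP[]. Qed.
HB.instance Definition _ (A : bop) :=
  GRing.isLinear.Build K X X *:%R A (@bop_linear A).

Fact bop_one_subproof : idfun \in bounded_linear.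
Proof. by apply/bounded_linearP; split=> //; exists 1 => // x; rewrite mul1r. Qed.

Definition bop_one := Bop bop_one_subproof.

Fact bop_mul_subproof (A B : bop) : (A \o B) \in bounded_linear.
Proof.
case: A B => [f /= /bounded_linearP[lf [M M0 fM]]].
case=> [g /= /bounded_linearP[lg [N N0 gN]]].
apply/bounded_linearP; split=> [a u v|]; first by rewrite /= lg lf.
exists (M * N); first exact: mulr_ge0.
by move=> x /=; rewrite (le_trans (fM _))// -mulrA ler_wpM2l.
Qed.

Definition bop_mul A B := Bop (bop_mul_subproof A B).

Fact bop_mulA : associative bop_mul.
Proof. by move=> A B C; apply: val_inj. Qed.
Fact bop_mul1r : left_id bop_one bop_mul.
Proof. by move=> A; apply: val_inj. Qed.
Fact bop_mulr1 : right_id bop_one bop_mul.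
Proof. by move=> A; apply: val_inj. Qed.
Fact bop_mulDl : left_distributive bop_mul +%R.
Proof. by move=> A B C; apply: val_inj. Qed.
Fact bop_mulDr : right_distributive bop_mul +%R.
Proof. by move=> A B C; apply/val_inj/funext => x; exact: (linearD A). Qed.

HB.instance Definition _ := GRing.Zmodule_isPzRing.Build bop
  bop_mulA bop_mul1r bop_mulr1 bop_mulDl bop_mulDr.

Definition finite_rank (A : bop) :=
  exists m (v : 'I_m -> X), range A = lin_span v.

Definition standard_operator_algebra (U : {pred bop}) :=
  [/\ submod_closed U, GRing.mulr_2closed U & forall A, finite_rank A -> A \in U].

Definition strong_operator_topology : topologicalType :=
  initial_topology (fun A : bop => (A : X -> X) : {ptws X -> X}).

End BoundedOperators.

Section UnitalStandardOperatorAlgebra.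
Variables (K : numFieldType) (X : normedModType K).

Record unital_soa := UnitalSoa {
  soa_pred : {pred bop X};
  soa_standard : standard_operator_algebra soa_pred;
  soa_unital : 1 \in soa_pred }.

Variable U : unital_soa.

Fact soa_submod : submod_closed (soa_pred U).
Proof. by case: (soa_standard U). Qed.

Fact soa_subring : subring_closed (soa_pred U).
Proof.
split; first exact: soa_unital.
  by have [_] := GRing.submod_closedB soa_submod.
by case: (soa_standard U).
Qed.

Record soa_sort := Soa { soa_val :> bop X; _ : soa_val \in soa_pred U }.

HB.instance Definition _ := [isSub for soa_val].
HB.instance Definition _ := [Choice of soa_sort by <:].
HB.instance Definition _ :=
  GRing.SubChoice_isSubPzRing.Build (bop X) (soa_pred U) soa_sort soa_subring.
HB.instance Definition _ := GRing.SubZmodule_isSubLmodule.Build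
  K (bop X) (soa_pred U) soa_sort (GRing.submod_closed_semi soa_submod).

Definition relative_sot : topologicalType := initial_topology
  (fun A : soa_sort => (A : bop X) : strong_operator_topology X).

End UnitalStandardOperatorAlgebra.

Coercion soa_sort : unital_soa >-> Sortclass.

(* Main.v *)
Require Import Defs.
From HB Require Import structures.
From mathcomp Require Import all_boot all_order all_algebra.
From mathcomp Require Import ring complex.
From mathcomp Require Import all_classical all_reals all_analysis.

Set Implicit Arguments.
Unset Strict Implicit.
Unset Printing Implicit Defensive.

Import Order.TTheory GRing.Theory Num.Theory.
Import numFieldNormedType.Exports.

Local Open Scope classical_set_scope.
Local Open Scope ring_scope.

(** A map A |-> lambda A + mu(A) I with mu vanishing on all n-fold commutators
    satisfies every condition, because a scalar summand is invisible to
    brackets. Every condition clearly implies one of the two weakest ones, on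
    zero products a1 a2 = 0 in the first or in the second argument, so the
    content is that either of these yields such a decomposition.

    The algebra U is prime and contains a rank one idempotent e, with e U e
    consisting of multiples of e; the Hahn-Banach theorem provides enough rank
    one operators for this, and is obtained here from minimal sublinear maps.
    Testing the zero product condition on the entries of the Peirce
    decomposition of e, and on the idempotents e + u with u in e U (1 - e),
    determines phi entry by entry: phi is lambda times the identity plus a map
    with central values (centralizer_zero_product). Off-diagonal entries are
    reproduced, up to sign, by bracketing with e, which reduces n arguments to
    two. The condition on the second argument is the one on the first in the
    opposite ring (centralizer_zero_product_r). The centre consists of the
    scalars, so phi A = lambda A + mu(A) I.

    It remains to see that mu kills all n-fold commutators; the hypothesis
    gives this when a1 a2 = 0. A commutator whose first entry p e q has rank
    one is a sum of commutators of zero products (ideal_bracket_eq0). Strong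
    continuity makes mu(A) depend only on the values of A at finitely many
    vectors (continuous_finitely_supported), a property inherited by
    A |-> mu(p_n(A, a2, ..., an)). Finitely many values of an operator are
    matched by an operator of finite rank, so the finite rank case suffices
    (finitely_supported_eq0). This is the only use of continuity. *)

(** * Maps preserving differences *)

Section DifferenceMorphisms.
Variables (V W : zmodType) (l : V -> W).
Hypothesis lB : {morph l : x y / x - y}.

Lemma morphB0 : l 0 = 0.
Proof. by rewrite -[0 in LHS](subrr 0) lB subrr. Qed.

Lemma morphBN x : l (- x) = - l x.
Proof. by rewrite -[- x]sub0r lB morphB0 sub0r. Qed.

Lemma morphBD x y : l (x + y) = l x + l y.
Proof. by rewrite -[y in LHS]opprK lB morphBN opprK. Qed.

End DifferenceMorphisms.

(** * Iterated brackets and central elements *)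

Section Brackets.
Variable A : pzRingType.
Implicit Types (a b c x y z : A) (s : seq A).

Definition central z := forall a, z * a = a * z.

Definition prime_ring :=
  forall a b, (forall y, a * y * b = 0) -> a = 0 \/ b = 0.

(** The iterated commutator [...[[x, s_1], s_2], ...]: the commutator p_n of
    a, b followed by the entries of s is ad s [a, b]. *)
Definition ad s x : A := foldl (@lie_bracket A) x s.

Lemma lie_bracketBl a b c :
  lie_bracket (a - b) c = lie_bracket a c - lie_bracket b c.
Proof.
rewrite /lie_bracket mulrBl mulrBr !opprB addrACA [RHS]addrACA.
by rewrite [- (b * c) + _]addrC.
Qed.

Lemma adB s : {morph ad s : x y / x - y}.
Proof.
by elim: s => // c s IH x y; rewrite /ad /= lie_bracketBl; apply: IH.
Qed.

Lemma ad0 s : ad s 0 = 0.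
Proof. exact: morphB0 (adB s). Qed.

Lemma adN s x : ad s (- x) = - ad s x.
Proof. exact: morphBN (adB s) x. Qed.

Lemma ad_fixed h x m : lie_bracket x h = x -> ad (nseq m h) x = x.
Proof. by move=> hx; elim: m => // m; rewrite /ad /= hx. Qed.

Lemma centralD x y : central x -> central y -> central (x + y).
Proof. by move=> cx cy a; rewrite mulrDl mulrDr cx cy. Qed.

Lemma centralN x : central x -> central (- x).
Proof. by move=> cx a; rewrite mulNr mulrN cx. Qed.

Lemma centralM x y : central x -> central y -> central (x * y).
Proof. by move=> cx cy a; rewrite -mulrA cy mulrA cx mulrA. Qed.

(** Iterated brackets are linear over the centre, and a central summand in
    either entry of a bracket is invisible: this is why a map differing from
    a central multiplication by central values commutes with brackets. *)
Lemma ad_centralZ z s x : central z -> ad s (z * x) = z * ad s x.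
Proof.
move=> cz; elim: s x => // c s IH x; rewrite /ad /= -IH; congr (foldl _ _ s).
by rewrite /lie_bracket mulrBr !mulrA (cz c).
Qed.

Lemma lie_bracket_centrall l x c b : central l -> central c ->
  lie_bracket (l * x + c) b = l * lie_bracket x b.
Proof.
move=> cl cc; rewrite /lie_bracket mulrDl mulrDr cc opprD addrACA subrr addr0.
by rewrite mulrBr !mulrA (cl b).
Qed.

Lemma lie_bracket_centralr l x c a : central l -> central c ->
  lie_bracket a (l * x + c) = l * lie_bracket a x.
Proof.
move=> cl cc; rewrite /lie_bracket mulrDl mulrDr cc opprD addrACA subrr addr0.
by rewrite mulrBr !mulrA (cl a).
Qed.

Hypothesis prA : prime_ring.

Lemma prime_central z x : central z -> z * x = 0 -> z = 0 \/ x = 0.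
Proof. by move=> cz zx0; apply: prA => y; rewrite cz -mulrA zx0 mulr0. Qed.

(** If c = [x, a] is central, so is [x, x * a] = x * c; commuting the latter
    with a gives c * c = 0, and primeness kills c. *)
Lemma central_bracket x :
  (forall a, central (lie_bracket x a)) -> central x.
Proof.
move=> cx a; set c := lie_bracket x a.
have xc : lie_bracket x (x * a) = x * c.
  by rewrite /lie_bracket mulrBr !mulrA.
have : c * c = 0.
  have := cx (x * a) a; rewrite xc -/c.
  by rewrite -mulrA (cx a a) !mulrA => /eqP; rewrite -subr_eq0 -mulrBl => /eqP.
by case/(prime_central (cx a)) => /eqP; rewrite subr_eq0 => /eqP.
Qed.

(** An element annihilated by all iterated brackets of a fixed length is
    central, by peeling off one bracket at a time. *)
Lemma central_ad m x :
  (forall s, size s = m -> ad s x = 0) -> central x.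
Proof.
elim: m x => [|m IH] x ad0x.
  by move=> a; have /= -> := ad0x [::] erefl; rewrite mul0r mulr0.
apply: central_bracket => a; apply: IH => s sm.
by apply: (ad0x (a :: s)); rewrite /= sm.
Qed.

End Brackets.

(** * Centralizers at zero products in a prime ring *)

Section Centralizer.
Variable A : pzRingType.
Implicit Types (a b c d g h u v x y z : A) (s : seq A).

(** In the application e is a rank one idempotent, and u0, v0 are rank one
    operators, matrix units linking e to an idempotent orthogonal to it. *)
Variable e : A.
Hypotheses (prA : prime_ring A) (ee : e * e = e) (e0 : e <> 0).
Hypothesis corner : forall y, exists2 z, central z & e * y * e = z * e.

Variables u0 v0 : A.
Hypotheses (u0e : u0 * e = 0) (v0e : v0 * e = v0)
  (ev0 : e * v0 = 0) (u0v0 : u0 * v0 = e).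

Variables (phi : A -> A) (m : nat).
Hypothesis phiB : {morph phi : x y / x - y}.
Hypothesis phiZ : forall z a, central z -> phi (z * a) = z * phi a.
Hypothesis phi_ad : forall a b s, size s = m -> a * b = 0 ->
  phi (ad s (lie_bracket a b)) = ad s (lie_bracket (phi a) b).

Let phi0 := morphB0 phiB.
Let phiN := morphBN phiB.
Let phiD := morphBD phiB.

Let ef : e * (1 - e) = 0.
Proof. by rewrite mulrBr mulr1 ee subrr. Qed.
Let fe : (1 - e) * e = 0.
Proof. by rewrite mulrBl mul1r ee subrr. Qed.

(** When a * g = g * a = 0 the hypothesis forces the bracket c of phi a and g
    to be central; as g * c * g = 0, primeness gives c = 0 or g = 0. *)
Lemma phi_commute_idempotent a g :
  g * g = g -> a * g = 0 -> g * a = 0 -> phi a * g = g * phi a.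
Proof.
move=> gg ag ga; set c := lie_bracket (phi a) g.
have cc : central c.
  apply: (central_ad prA (m := m)) => s sm.
  by rewrite -phi_ad // /lie_bracket ag ga subrr ad0 phi0.
have : c * g = 0.
  rewrite -gg mulrA cc /c /lie_bracket mulrBr mulrBl.
  by rewrite !mulrA gg -!mulrA gg subrr.
case/(prime_central prA cc) => [/eqP|->]; last by rewrite mulr0 mul0r.
by rewrite subr_eq0 => /eqP.
Qed.

Lemma phi_idempotent_commute g : g * g = g -> phi g * g = g * phi g.
Proof.
move=> gg; have := @phi_commute_idempotent g (1 - g).
rewrite !mulrBr !mulrBl !mulr1 !mul1r gg !subrr subr0 => /(_ erefl erefl erefl).
by move/addrI/oppr_inj.
Qed.

(** Passing from m + 2 arguments to two: bracketing m times with an h which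
    fixes both sides removes the iterated bracket. Off-diagonal entries for
    the Peirce decomposition of e are fixed by bracketing with e or - e. *)
Lemma phi_bracket h a b :
  lie_bracket (lie_bracket a b) h = lie_bracket a b ->
  lie_bracket (lie_bracket (phi a) b) h = lie_bracket (phi a) b ->
  a * b = 0 -> phi (lie_bracket a b) = lie_bracket (phi a) b.
Proof.
move=> ab_h pab_h ab0.
by have := phi_ad (size_nseq m h) ab0; rewrite !ad_fixed.
Qed.

(* Membership in e A (1 - e) and in (1 - e) A e. *)
Let upper u := e * u = u /\ u * e = 0.
Let lower v := v * e = v /\ e * v = 0.

Let upper_bracket u : upper u -> lie_bracket u (- e) = u.
Proof.
by case=> eu ue; rewrite /lie_bracket mulrN mulNr ue eu oppr0 add0r opprK.
Qed.

Let lower_bracket v : lower v -> lie_bracket v e = v.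
Proof. by case=> ve ev; rewrite /lie_bracket ve ev subr0. Qed.

Let phi_upper a b : upper (lie_bracket a b) ->
  upper (lie_bracket (phi a) b) -> a * b = 0 ->
  phi (lie_bracket a b) = lie_bracket (phi a) b.
Proof.
by move=> /upper_bracket h1 /upper_bracket h2; exact: (phi_bracket h1 h2).
Qed.

Let phi_lower a b : lower (lie_bracket a b) ->
  lower (lie_bracket (phi a) b) -> a * b = 0 ->
  phi (lie_bracket a b) = lie_bracket (phi a) b.
Proof.
by move=> /lower_bracket h1 /lower_bracket h2; exact: (phi_bracket h1 h2).
Qed.

Let upperN u : upper (- u) -> upper u.
Proof.
by case; rewrite mulrN mulNr => /oppr_inj ? /eqP; rewrite oppr_eq0 => /eqP.
Qed.

Let P := phi e.
Let Pe : P * e = e * P. Proof. exact: phi_idempotent_commute. Qed.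

Section EntryFormulas.
Variable z : A.
Hypotheses (cz : central z) (ePe : e * P * e = z * e).

Let Pez : P * e = z * e. Proof. by rewrite -ePe -Pe -mulrA ee. Qed.

(** The product e * v vanishes and [e, v] = - v, so the hypothesis expresses
    phi v through P. *)
Lemma phi_lower_entry v : lower v -> phi v = z * v - P * v.
Proof.
move=> [ve ev].
have b1 : lie_bracket e v = - v by rewrite /lie_bracket ev ve sub0r.
have b2 : lie_bracket P v = P * v - z * v.
  by rewrite /lie_bracket -{2}ve -mulrA -Pe Pez mulrA -cz -mulrA ve.
have := @phi_lower e v; rewrite b1 -/P b2 phiN => H.
apply: oppr_inj; rewrite H ?opprB //; split.
- by rewrite mulNr ve.
- by rewrite mulrN ev oppr0.
- by rewrite mulrBl -!mulrA ve.
- by rewrite mulrBr !mulrA -Pe -cz -!mulrA ev !mulr0 subr0.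
Qed.

(** The zero product (1 - e) * u shows that phi u is again in e A (1 - e); its
    value is then read off from the fact that phi (e + u) commutes with the
    idempotent e + u. *)
Lemma phi_upper_entry u : upper u -> phi u = z * u - u * P.
Proof.
move=> uu; have [eu ue] := uu.
pose Q := phi (1 - e).
have Qe : Q * e = e * Q by apply: phi_commute_idempotent.
have b1 : lie_bracket (1 - e) u = - u.
  by rewrite /lie_bracket mulrBl mulrBr eu ue mul1r mulr1 subrr subr0 sub0r.
have [epu pue] : upper (phi u).
  have uQ : upper (lie_bracket Q u).
    rewrite /lie_bracket; split.
      by rewrite mulrBr !mulrA eu -Qe -[Q * e * u]mulrA eu.
    by rewrite mulrBl -!mulrA ue Qe mulrA ue mul0r mulr0 subrr.
  have := @phi_upper (1 - e) u; rewrite b1 phiN -/Q => H.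
  apply: upperN; rewrite H //.
    by split; rewrite ?mulrN ?mulNr ?eu ?ue ?oppr0.
  by rewrite mulrBl eu mul1r subrr.
have uu0 : u * u = 0 by rewrite -{2}eu mulrA ue mul0r.
have pu0 : phi u * u = 0 by rewrite -[X in _ * X]eu mulrA pue mul0r.
have up0 : u * phi u = 0 by rewrite -epu mulrA ue mul0r.
have Pu : P * u = z * u by rewrite -{1}eu mulrA Pez -mulrA eu.
have := @phi_idempotent_commute (e + u).
rewrite mulrDl !mulrDr ee eu ue uu0 !addr0 => /(_ erefl).
rewrite phiD -/P !mulrDl !mulrDr epu pue pu0 up0 !addr0 -Pe Pu -addrA.
by move/addrI => ->; rewrite addrK.
Qed.

(** For d in (1 - e) A (1 - e) and u in e A (1 - e) the product d * u vanishes,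
    so the hypothesis compares phi d with phi (u * d), known by the previous
    lemma. Since u is arbitrary, primeness determines phi d. *)
Lemma phi_corner_entry d : d * e = 0 -> e * d = 0 ->
  exists2 r, central r & phi d = r + (z * d - d * P).
Proof.
move=> de ed; pose D := phi d.
have De : D * e = e * D by apply: phi_commute_idempotent.
have [r cr eDe] := corner D; exists r => //.
have Der : D * e = r * e by rewrite -eDe -De -mulrA ee.
have key u : upper u -> u * (D - (r + (z * d - d * P))) = 0.
  move=> uu; have [eu ue] := uu.
  have ud : upper (u * d) by split; rewrite ?mulrA ?eu // -mulrA de mulr0.
  have du : d * u = 0 by rewrite -eu mulrA de mul0r.
  have b1 : lie_bracket d u = - (u * d) by rewrite /lie_bracket du sub0r.
  have b2 : lie_bracket D u = r * u - u * D.
    by rewrite /lie_bracket -{1}eu mulrA Der -mulrA eu.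
  have := @phi_upper d u; rewrite b1 b2 phiN (phi_upper_entry ud) => H.
  have {}H : z * (u * d) - u * d * P = u * D - r * u.
    rewrite -[LHS]opprK H ?opprB //; split.
    - by case: ud => eud _; rewrite mulrN eud.
    - by case: ud => _ ude; rewrite mulNr ude oppr0.
    - by rewrite mulrBr !mulrA -(cr e) -mulrA eu.
    - by rewrite mulrBl -!mulrA ue De mulrA ue mul0r mulr0 subrr.
  rewrite mulrBr !mulrDr mulrN -(cr u) [u * (z * d)]mulrA -(cz u) -mulrA.
  by rewrite [u * (d * P)]mulrA H [_ + (_ - _)]addrC subrK subrr.
set x := D - _ in key.
have ex : e * x = 0.
  rewrite /x mulrBr !mulrDr -De Der cr mulrN !mulrA ed -cz -mulrA ed.
  by rewrite mulr0 mul0r subrr addr0 subrr.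
have xf : (1 - e) * x = x by rewrite mulrBl mul1r ex subr0.
have : e = 0 \/ x = 0.
  apply: prA => y; rewrite -xf mulrA key //; split.
  - by rewrite !mulrA ee.
  - by rewrite -mulrA fe mulr0.
by case=> // /eqP; rewrite subr_eq0 => /eqP.
Qed.

(** The remaining unknown is the lower corner of P. Computing phi (d * v0) for
    d = v * u0 in two ways shows that P commutes with d on v0. As u0 * v0 = e
    and v = v * e, left multiplication by P acts on (1 - e) A e as the central
    element s by which u0 * P * v0 compresses to the corner of e. *)
Lemma phi_idempotentE : exists2 s, central s & P = z * e + s * (1 - e).
Proof.
have [s cs es] := corner (u0 * P * v0).
have comm v : lower v -> P * v = s * v.
  move=> vv; have [ve ev] := vv; pose d := v * u0.
  have ed : e * d = 0 by rewrite mulrA ev mul0r.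
  have de : d * e = 0 by rewrite -mulrA u0e mulr0.
  have dv : lower (d * v0) by rewrite -mulrA u0v0 ve.
  have vd : v0 * d = 0 by rewrite -v0e -mulrA ed mulr0.
  have b1 : lie_bracket v0 d = - (d * v0) by rewrite /lie_bracket vd sub0r.
  have pv0 : phi v0 = z * v0 - P * v0 by apply: phi_lower_entry.
  have b2 : lie_bracket (phi v0) d = d * P * v0 - z * (d * v0).
    rewrite /lie_bracket pv0 mulrBl -[z * v0 * d]mulrA -[P * v0 * d]mulrA vd.
    rewrite !mulr0 subrr sub0r mulrBr opprB [d * (P * v0)]mulrA.
    by rewrite [d * (z * v0)]mulrA -(cz d) -[z * d * v0]mulrA.
  have := @phi_lower v0 d; rewrite b1 b2 phiN (phi_lower_entry dv) => H.
  have {}H : P * (d * v0) = d * P * v0.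
    apply: (@addIr _ (- (z * (d * v0)))); rewrite -H ?opprB //; split.
    - by rewrite mulNr -mulrA v0e.
    - by rewrite mulrN mulrA ed mul0r oppr0.
    - by rewrite mulrBl -!mulrA v0e.
    - rewrite mulrBr -[d * P * v0]mulrA mulrA ed mul0r mulrA -(cz e) -mulrA.
      by rewrite [e * (d * v0)]mulrA ed mul0r mulr0 subrr.
  move: H; rewrite -[d * v0]mulrA u0v0 ve => ->.
  have -> : d * P * v0 = v * (e * (u0 * P * v0) * e).
    by rewrite !mulrA ve -[_ * v0 * e]mulrA v0e.
  by rewrite es mulrA -cs -mulrA ve.
have Pf : (P - s) * (1 - e) = 0.
  have : (P - s) * (1 - e) = 0 \/ e = 0.
    apply: prA => y; rewrite -!mulrA mulrBl comm ?subrr //; split.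
    - by rewrite -!mulrA ee.
    - by rewrite !mulrA ef !mul0r.
  by case.
exists s => //; move: Pf; rewrite mulrBl => /eqP; rewrite subr_eq0 => /eqP <-.
by rewrite -Pez -mulrDr addrCA subrr addr0 mulr1.
Qed.

(** Each Peirce entry is multiplied by z - s modulo the centre; e A e is covered
    by the linearity of phi over the centre. *)
Lemma phi_minus_scalar_central :
  exists2 l, central l & forall x, central (phi x - l * x).
Proof.
have [s cs Pzs] := phi_idempotentE.
(* P = z e + s (1 - e) = (z - s) e + s. *)
exists (z - s) => [|x]; first by apply: centralD => //; apply: centralN.
pose a := e * x * e; pose u := e * x * (1 - e).
pose v := (1 - e) * x * e; pose d := (1 - e) * x * (1 - e).
have -> : x = (a + u) + (v + d).
  rewrite /a /u /v /d -!mulrDr addrCA subrr addr0 !mulr1.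
  by rewrite -mulrDl addrCA subrr addr0 mul1r.
have [k ck ak] := corner x.
have pa : phi a - (z - s) * a = k * s.
  rewrite /a ak phiZ // -/P Pzs mulrBr mulr1 mulrA -(ck (z - s)) -mulrA -mulrBr.
  by congr (_ * _); rewrite mulrBl opprB addrC addrA subrK addrC subrK.
have xP y : y * e = 0 -> y * P = s * y.
  move=> ye; rewrite Pzs mulrDr !mulrA -cz -cs -mulrA ye mulr0 add0r.
  by rewrite -mulrA mulrBr mulr1 ye subr0.
have pu : phi u = (z - s) * u.
  rewrite phi_upper_entry ?xP ?mulrBl //; last split.
  - by rewrite /u -mulrA fe mulr0.
  - by rewrite /u !mulrA ee.
  - by rewrite /u -mulrA fe mulr0.
have pv : phi v = (z - s) * v.
  have ev : e * v = 0 by rewrite /v !mulrA ef !mul0r.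
  rewrite phi_lower_entry; last by split=> //; rewrite /v -!mulrA ee.
  rewrite Pzs !mulrBl mulrDl -!mulrA ev mulr0 add0r.
  by rewrite [(1 - e) * v]mulrBl ev mul1r subr0.
have [||r cr pd] := @phi_corner_entry d.
- by rewrite /d -!mulrA fe !mulr0.
- by rewrite /d !mulrA ef !mul0r.
rewrite xP -?mulrBl in pd; last by rewrite /d -!mulrA fe !mulr0.
rewrite !phiD pu pv pd !mulrDr.
rewrite [_ * v + (r + _)]addrCA [_ + (r + _)]addrA.
rewrite [_ * a + _ + _]addrC addrKA addrAC [_ * a + _]addrC addrKA pa.
by apply: centralD => //; apply: centralM.
Qed.

End EntryFormulas.

Lemma centralizer_zero_product :
  exists2 l, central l & forall x, central (phi x - l * x).
Proof. by have [z cz /(phi_minus_scalar_central cz)] := corner P. Qed.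

End Centralizer.

Section Opposite.
Variable A : pzRingType.

(** In the opposite ring every bracket changes sign. *)
Lemma ad_converse (s : seq A) (x : A) :
  @ad A^c s x = @ad A s (if odd (size s) then - x else x).
Proof.
elim: s x => [|c s IH] x //.
have -> : @ad A^c (c :: s) x = @ad A^c s (- @lie_bracket A x c).
  by rewrite /ad /= /lie_bracket opprB.
rewrite IH /ad /=; congr (foldl _ _ s).
case: odd => /=; rewrite ?opprK //.
by rewrite /lie_bracket mulNr mulrN opprB opprK addrC.
Qed.

Lemma central_converse (z : A) : @central A^c z <-> @central A z.
Proof. by split=> cz a; rewrite [RHS]cz. Qed.

End Opposite.

(** The condition on the second argument is the condition on the first one in
    the opposite ring: a product a * b = 0 becomes a product of b and a, and
    the signs of the brackets cancel on both sides. *)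
Lemma centralizer_zero_product_r (A : pzRingType) (e : A) :
  prime_ring A -> e * e = e -> e <> 0 ->
  (forall y : A, exists2 z : A, central z & e * y * e = z * e) ->
  forall u v : A, e * u = u -> u * e = 0 -> e * v = 0 -> u * v = e ->
  forall (phi : A -> A) (m : nat),
  {morph phi : x y / x - y} ->
  (forall z a : A, central z -> phi (z * a) = z * phi a) ->
  (forall (a b : A) (s : seq A), size s = m -> a * b = 0 ->
     phi (ad s (lie_bracket a b)) = ad s (lie_bracket a (phi b))) ->
  exists2 l, central l & forall x, central (phi x - l * x).
Proof.
move=> prA ee e0 corner u v eu ue ev uv phi m phiB phiZ phi_ad.
have prC : prime_ring A^c.
  move=> a b ab0; have [y|->|->] := prA b a; [|by right|by left].
  by rewrite -mulrA; apply: ab0.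
have cornerC (y : A^c) :
    exists2 z : A^c, central z & (e : A^c) * y * e = z * e.
  have [z cz zy] := corner y; exists z; first by apply/(@central_converse A).
  by apply: etrans (cz e); apply: etrans zy; apply: mulrA.
have phiZC (z a : A^c) : central z -> phi (z * a) = z * (phi a : A^c).
  move=> /(@central_converse A) cz.
  have H : phi (@GRing.mul A a z) = @GRing.mul A (phi a) z by rewrite -!cz phiZ.
  exact: H.
have phi_adC (a b : A^c) (s : seq A^c) : size s = m -> a * b = 0 ->
    phi (ad s (lie_bracket a b)) = ad s (lie_bracket (phi a : A^c) b).
  move=> sm ab0; rewrite !(@ad_converse A).
  have bracketC (x y : A) : @lie_bracket A^c x y = @lie_bracket A y x by [].
  have H := phi_ad b a s sm ab0.
  by rewrite !bracketC; case: odd; rewrite // !adN (morphBN phiB) H.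
have [l cl lx] :=
  centralizer_zero_product prC ee e0 cornerC ev eu ue uv phiB phiZC phi_adC.
exists l; first by apply/(@central_converse A).
by move=> x; apply/(@central_converse A); have := lx x; rewrite cl.
Qed.

(** * Functionals vanishing on commutators of zero products *)

Section FiniteRankBrackets.
Variables (A : pzRingType) (e : A) (V : zmodType) (l : A -> V).
Hypothesis ee : e * e = e.
Hypothesis corner : forall y, exists2 z, central z & e * y * e = z * e.
Hypothesis lB : {morph l : x y / x - y}.
Hypothesis l_zero_product : forall a b, a * b = 0 -> l (lie_bracket a b) = 0.
Implicit Types (a b c p q x y : A).

Let l0 := morphB0 lB.
Let lN := morphBN lB.
Let lD := morphBD lB.

Let lC a b : l (lie_bracket a b) = - l (lie_bracket b a).
Proof. by rewrite -lN /lie_bracket opprB. Qed.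

Let lDl a b c :
  l (lie_bracket (a + b) c) = l (lie_bracket a c) + l (lie_bracket b c).
Proof.
by rewrite -lD; congr l; rewrite /lie_bracket mulrDl mulrDr opprD addrACA.
Qed.

Let lDr a b c :
  l (lie_bracket c (a + b)) = l (lie_bracket c a) + l (lie_bracket c b).
Proof. by rewrite lC lDl opprD -!lC. Qed.

Lemma corner_commutes x y : lie_bracket (e * x * e) (e * y * e) = 0.
Proof.
have [z cz ->] := corner x; set b := e * y * e.
have eb : e * b = b by rewrite /b !mulrA ee.
have be : b * e = b by rewrite /b -mulrA ee.
by rewrite /lie_bracket -mulrA eb (mulrA b) -cz -mulrA be subrr.
Qed.

(** The product of u and v need not vanish, but that of e + u and v - u * v
    does; all other terms in the expansion of its commutator are harmless. *)
Lemma off_diagonal_bracket_eq0 u v :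
  e * u = u -> u * e = 0 -> v * e = v -> e * v = 0 ->
  l (lie_bracket u v) = 0.
Proof.
move=> eu ue ve ev.
have uu : u * u = 0 by rewrite -{2}eu mulrA ue mul0r.
have : (e + u) * (v - u * v) = 0.
  by rewrite mulrDl !mulrBr ev !mulrA eu uu mul0r sub0r subr0 addrC subrr.
move=> /l_zero_product; rewrite lDl !lDr.
rewrite [l (lie_bracket e v)]l_zero_product // add0r.
rewrite [l (lie_bracket u (- _))]l_zero_product; last first.
  by rewrite mulrN mulrA uu mul0r oppr0.
have -> : lie_bracket e (- (u * v)) = 0.
  by rewrite /lie_bracket mulrN mulNr mulrA eu -mulrA ve subrr.
by rewrite l0 add0r addr0.
Qed.

Lemma right_left_bracket_eq0 x y : l (lie_bracket (x * e) (e * y)) = 0.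
Proof.
have -> : x * e = e * x * e + (1 - e) * x * e.
  by rewrite -!mulrDl addrCA subrr addr0 mul1r.
have -> : e * y = e * y * e + e * y * (1 - e).
  by rewrite -mulrDr addrCA subrr addr0 mulr1.
have ef : e * (1 - e) = 0 by rewrite mulrBr mulr1 ee subrr.
have fe : (1 - e) * e = 0 by rewrite mulrBl mul1r ee subrr.
rewrite lDl !lDr corner_commutes l0 add0r.
rewrite [l (lie_bracket (e * x * e) _)]lC l_zero_product; last first.
  by rewrite !mulrA -[_ * (1 - e) * e]mulrA fe mulr0 !mul0r.
rewrite [l (lie_bracket _ (e * y * e))]lC l_zero_product; last first.
  by rewrite !mulrA -[_ * e * (1 - e)]mulrA ef mulr0 !mul0r.
rewrite lC off_diagonal_bracket_eq0 ?oppr0 ?addr0 //.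
- by rewrite !mulrA ee.
- by rewrite -!mulrA fe !mulr0.
- by rewrite -!mulrA ee.
- by rewrite !mulrA ef !mul0r.
Qed.

(** The cyclic identity [x y, c] = [x, y c] + [y, c x], with x = p e and
    y = e q, reduces to commutators of an element of A e with one of e A. *)
Lemma ideal_bracket_eq0 p q c : l (lie_bracket (p * e * q) c) = 0.
Proof.
have -> : lie_bracket (p * e * q) c =
  lie_bracket (p * e) (e * (q * c)) + lie_bracket (e * q) (c * p * e).
  rewrite /lie_bracket !mulrA -[p * e * e]mulrA ee -[c * p * e * e]mulrA ee.
  by rewrite addrA subrK.
by rewrite lD right_left_bracket_eq0 lC right_left_bracket_eq0 oppr0 addr0.
Qed.

End FiniteRankBrackets.

(** * The Hahn-Banach theorem *)

Section HahnBanach.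
Local Open Scope complex_scope.
Variables (R : realType) (V : lmodType R[i]).
Implicit Types (q : V -> R) (x y v : V) (r t : R).

(** Complex scalars restricted to the reals: only real scalars act here. *)
Definition sublinear q :=
  (forall x y, q (x + y) <= q x + q y) /\
  (forall t x, 0 < t -> q (t%:C *: x) <= t * q x).

Let scale_realA r t x : r%:C *: (t%:C *: x) = (r * t)%:C *: x.
Proof. by rewrite scalerA rmorphM. Qed.

Lemma sublinearZ q t x : sublinear q -> 0 < t -> q (t%:C *: x) = t * q x.
Proof.
move=> [_ qZ] t0; apply/le_anti; rewrite qZ //= -ler_pdivlMl //.
have {1}-> : x = t^-1%:C *: (t%:C *: x).
  by rewrite scale_realA mulVf ?gt_eqF // rmorph1 scale1r.
by rewrite qZ ?invr_gt0.
Qed.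

Lemma sublinear0 q : sublinear q -> q 0 = 0.
Proof.
move=> sq; have := sublinearZ 0 sq (ltr0n R 2); rewrite scaler0.
rewrite mulr_natl mulr2n => /eqP.
by rewrite -subr_eq0 opprD addrA subrr sub0r oppr_eq0 => /eqP.
Qed.

Lemma sublinear_opp q x : sublinear q -> - q (- x) <= q x.
Proof.
move=> sq; rewrite -subr_ge0 opprK -(sublinear0 sq) -(subrr x).
by case: sq => qD _; apply: qD.
Qed.

(** Infima of suitably directed families; used both for the infimum along a ray
    and for the infimum of a chain. *)
Lemma sublinear_inf (T : Type) (D : set T) (a : T -> V -> R) :
  D !=set0 ->
  (forall x, has_lbound [set a t x | t in D]) ->
  (forall (t t' : T) x x', D t -> D t' ->
     exists2 s, D s & a s (x + x') <= a t x + a t' x') ->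
  (forall (t : T) r x, D t -> 0 < r ->
     exists2 s, D s & a s (r%:C *: x) <= r * a t x) ->
  exists2 q, sublinear q & forall (t : T) x, D t -> q x <= a t x.
Proof.
move=> D0 lb aD aZ; pose q x := inf [set a t x | t in D].
have qa (t : T) x : D t -> q x <= a t x.
  by move=> Dt; apply: ge_inf => //; exists t.
have qge x c : (forall t : T, D t -> c <= a t x) -> c <= q x.
  move=> H; apply: lb_le_inf; first by case: D0 => t Dt; exists (a t x), t.
  by move=> _ [t Dt <-]; apply: H.
exists q => //; split=> [x y|r x r0].
  rewrite -lerBlDr; apply: (qge) => t Dt; rewrite lerBlDr -lerBlDl.
  apply: (qge) => t' Dt'; rewrite lerBlDl.
  by have [s Ds] := aD t t' x y Dt Dt'; apply: le_trans; apply: qa.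
rewrite -ler_pdivrMl //; apply: (qge) => t Dt; rewrite ler_pdivrMl //.
by have [s Ds] := aZ t r x Dt r0; apply: le_trans; apply: qa.
Qed.

(** q' x is the infimum of q (x + t v) - t q v over t >= 0. Lowering q in this
    way is possible unless q (- v) = - q v already. *)
Lemma sublinear_shift q v : sublinear q ->
  exists q', [/\ sublinear q', forall x, q' x <= q x & q' (- v) <= - q v].
Proof.
move=> sq; pose a t x := q (x + t%:C *: v) - t * q v.
have qt t : 0 <= t -> q (t%:C *: v) = t * q v.
  rewrite le_eqVlt => /orP[/eqP <-|]; last exact: sublinearZ.
  by rewrite rmorph0 scale0r mul0r sublinear0.
have [||||q' sq' q'a] := @sublinear_inf R [set t | 0 <= t] a.
- by exists 0 => /=.
- move=> x; exists (- q (- x)) => _ [t /= t0 <-]; rewrite /a.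
  have := sq.1 (x + t%:C *: v) (- x); rewrite addrAC subrr add0r qt //.
  by rewrite lerBrDr [- _ + _]addrC lerBlDr.
- move=> t t' x x' /= t0 t'0; exists (t + t'); first exact: addr_ge0.
  rewrite /a addrACA -opprD -mulrDl lerD2r rmorphD scalerDl addrACA.
  by case: sq => + _; apply.
- move=> t r x /= t0 r0; exists (r * t); first by rewrite mulr_ge0 // ltW.
  rewrite /a mulrBr mulrA lerD2r -scale_realA -scalerDr.
  by case: sq => _; apply.
exists q'; split=> // [x|].
  by rewrite (le_trans (q'a 0 x _)) //= /a rmorph0 scale0r mul0r subr0 addr0.
rewrite (le_trans (q'a 1 (- v) _)) //= /a rmorph1 scale1r mul1r addNr.
by rewrite sublinear0 // sub0r.
Qed.

Definition real_linear (q : V -> R) :=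
  (forall x y, q (x + y) = q x + q y) /\ (forall t x, q (t%:C *: x) = t * q x).

(** Zorn's lemma: a chain of sublinear maps below p is bounded below at x by
    - p (- x), so its pointwise infimum is sublinear. *)
Lemma minimal_sublinear p : sublinear p ->
  exists q, [/\ sublinear q, forall x, q x <= p x &
    forall q', sublinear q' -> (forall x, q' x <= q x) -> q' = q].
Proof.
move=> sp; pose T := {q : V -> R | sublinear q /\ forall x, q x <= p x}.
(* The order is reversed: maximal elements are minimal maps. *)
pose le (s t : T) := `[< forall x, sval t x <= sval s x >].
have [||||[q [sq qp]] qmin] := @Zorn T le.
- by move=> s; apply/asboolP.
- move=> r s t /asboolP rs /asboolP st; apply/asboolP => x.
  exact: le_trans (st x) (rs x).
- move=> [s Hs] [t Ht] /asboolP /= st /asboolP /= ts.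
  have E : s = t by apply/funext => x; apply/le_anti; rewrite st ts.
  by case: _ / E in Ht st ts *; congr exist; apply: Prop_irrelevance.
- move=> C Ctot; have [->|/set0P C0] := eqVneq C set0.
    by exists (exist _ p (conj sp (fun x => lexx (p x)))) => s.
  have [|||q sq qC] := @sublinear_inf T C (fun s => sval s) C0.
  + move=> x; exists (- p (- x)) => _ [[s [ss sp']] /= _ <-].
    by rewrite (le_trans _ (sublinear_opp x ss)) // lerN2.
  + move=> s t x y Cs Ct.
    have [/asboolP ts|/asboolP st] := Ctot s t Cs Ct.
      exists t => //; have [[tD _] _] := svalP t.
      by rewrite (le_trans (tD x y)) // lerD2r.
    exists s => //; have [[sD _] _] := svalP s.
    by rewrite (le_trans (sD x y)) // lerD2l.
  + move=> s r x Cs r0; exists s => //.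
    by have [[_ sZ] _] := svalP s; apply: sZ.
  have qp x : q x <= p x.
    have [s Cs] := C0; apply: le_trans (qC s x Cs) _.
    by have [_] := svalP s; apply.
  exists (exist _ q (conj sq qp)) => s Cs; apply/asboolP => x /=.
  exact: qC.
exists q; split=> // q' sq' q'q.
have q'p x : q' x <= p x by apply: le_trans (q'q x) (qp x).
have := qmin (exist _ q' (conj sq' q'p)).
by case/(_ (asboolT q'q)) => /=.
Qed.

(** A minimal sublinear map is odd by the shift construction, hence linear.
    Starting from p shifted along v forces the value p v at v. *)
Lemma hahn_banach_real p v : sublinear p ->
  exists q, [/\ real_linear q, forall x, q x <= p x & q v = p v].
Proof.
move=> sp; have [p' [sp' p'p p'v]] := sublinear_shift v sp.
have [q [sq qp' qmin]] := minimal_sublinear sp'.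
have qN x : q (- x) = - q x.
  have [q' [sq' q'q q'x]] := sublinear_shift x sq.
  apply/le_anti; rewrite -{1}(qmin q') // q'x /=.
  by rewrite lerNl; have := sublinear_opp x sq.
exists q; split=> [|x|].
- split=> [x y|t x].
    have qD := sq.1; apply/le_anti; rewrite qD /=.
    by rewrite -lerBrDr -qN (le_trans _ (qD _ _)) // addrK.
  have [t0|t0|->] := ltgtP t 0.
  + rewrite -{1}[t]opprK rmorphN scaleNr qN sublinearZ ?oppr_gt0 //.
    by rewrite mulNr opprK.
  + exact: (sublinearZ x sq t0).
  + by rewrite rmorph0 scale0r mul0r sublinear0.
- exact: le_trans (qp' x) (p'p x).
- apply/le_anti; rewrite (le_trans (qp' v) (p'p v)) /=.
  by rewrite -lerN2 -qN (le_trans (qp' _)).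
Qed.

End HahnBanach.

Section BoundedFunctionals.
Local Open Scope complex_scope.

Lemma real_linearN (R : realType) (V : lmodType R[i]) (q : V -> R) x :
  real_linear q -> q (- x) = - q x.
Proof.
case=> _ qZ; rewrite -scaleN1r -(rmorph1 (real_complex R)) -rmorphN.
by rewrite qZ mulN1r.
Qed.

(** A real linear q is the real part of a complex linear map, whose imaginary
    part at x must be - q (i x). *)
Lemma complexification (R : realType) (V : lmodType R[i]) (q : V -> R) :
  real_linear q ->
  scalar (fun x => q x +i* - q ('i%C *: x)).
Proof.
move=> ql k x y; have [qD qZ] := ql.
have i2 : 'i%C * 'i%C = -1 :> R[i] by rewrite -expr2 sqr_i.
have qk u : q (k *: u) = complex.Re k * q u + complex.Im k * q ('i%C *: u).
  rewrite {1}[k]complexE scalerDl -scalerA [_ *: (_ *: u)]scalerA mulrC.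
  by rewrite -scalerA qD !qZ.
have qik : q ('i%C *: (k *: x)) =
    complex.Re k * q ('i%C *: x) - complex.Im k * q x.
  rewrite scalerA mulrC -scalerA qk scalerA i2 scaleN1r.
  by rewrite (real_linearN _ ql) mulrN.
rewrite qD qk scalerDr qD qik; case: k {qk qik} => a b.
by apply/eqP; rewrite eq_complex /=; apply/andP; split; apply/eqP; ring.
Qed.

Lemma norm_real_complex (R : rcfType) (t : R) : `|t%:C| = `|t|%:C.
Proof. by rewrite normc_def /= expr0n addr0 sqrtr_sqr. Qed.

Lemma norm_i (R : rcfType) : `|'i%C : R[i]| = 1.
Proof. by rewrite normc_def /= expr0n add0r expr1n sqrtr1. Qed.

Definition bounded_functional (K : numFieldType) (X : normedModType K)
    (g : X -> K) :=
  scalar g /\ exists2 M : K, 0 <= M & forall x, `|g x| <= M * `|x|.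

Section NormingFunctionals.
Variables (R : realType) (X : normedModType R[i]).

Definition real_norm (x : X) : R := complex.Re `|x|.

Lemma real_normE x : (real_norm x)%:C = `|x|.
Proof. by rewrite RRe_real // realE normr_ge0. Qed.

Lemma sublinear_real_norm : sublinear real_norm.
Proof.
split=> [x y|t x t0]; rewrite -lecR.
  by rewrite rmorphD /= !real_normE ler_normD.
rewrite rmorphM /= !real_normE normrZ.
by rewrite (@ger0_norm _ t%:C) // ler0c ltW.
Qed.

(** The complexification of a real functional dominated by the norm is bounded
    by twice the norm; its real part at v is the norm of v, so it can be
    normalized at v. *)
Lemma exists_bounded_functional (v : X) : v <> 0 ->
  exists2 g, bounded_functional g & g v = 1.
Proof.
move=> v0.
have [q [ql qle qv]] := hahn_banach_real v sublinear_real_norm.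
have qabs x : `|q x|%:C <= `|x|.
  rewrite -real_normE lecR ler_norml qle andbT lerNl.
  rewrite -(real_linearN x ql) (le_trans (qle _)) //.
  by rewrite -lecR !real_normE normrN.
pose g x := q x +i* - q ('i%C *: x).
have gs : scalar g := complexification ql.
have gv : g v != 0.
  rewrite eq_complex /= negb_and qv; apply/orP; left.
  apply/eqP => nv; apply: v0; apply/normr0_eq0.
  by rewrite -real_normE nv.
have gle x : `|g x| <= 2 * `|x|.
  have -> : g x = (q x)%:C - 'i%C * (q ('i%C *: x))%:C.
    by rewrite [LHS]complexE /= rmorphN mulrN.
  rewrite (le_trans (ler_normB _ _)) // mulr2n mulrDl mul1r lerD //.
    by rewrite norm_real_complex qabs.
  rewrite normrM norm_real_complex (le_trans (ler_wpM2l _ (qabs _))) //.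
  by rewrite normrZ mulrA norm_i !mul1r.
exists (fun y => (g v)^-1 * g y); last by rewrite mulVf.
split=> [k x y|]; first by rewrite gs mulrDr mulrCA.
exists (`|(g v)^-1| * 2); first by rewrite mulr_ge0.
by move=> x; rewrite normrM -mulrA ler_wpM2l.
Qed.

End NormingFunctionals.

End BoundedFunctionals.

(** * Rank one operators in a unital standard operator algebra *)

Section FunctionalArithmetic.
Variables (K : numFieldType) (X : normedModType K).
Implicit Types (g h : X -> K) (x y : X) (k : K).

Lemma functional0 g : bounded_functional g -> g 0 = 0.
Proof.
case=> /(_ 1 0 0) + _; rewrite scaler0 addr0 mul1r => /eqP.
by rewrite -subr_eq0 opprD addrA subrr sub0r oppr_eq0 => /eqP.
Qed.

Lemma functionalZ g k x : bounded_functional g -> g (k *: x) = k * g x.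
Proof. by move=> gb; have := gb.1 k x 0; rewrite functional0 // !addr0. Qed.

Lemma functionalD g x y : bounded_functional g -> g (x + y) = g x + g y.
Proof. by case=> /(_ 1 x y); rewrite scale1r mul1r. Qed.

Lemma bounded_functionalB g h k :
  bounded_functional g -> bounded_functional h ->
  bounded_functional (fun y => g y - k * h y).
Proof.
move=> [gs [M M0 gM]] [hs [N N0 hN]]; split=> [l x y|].
  by rewrite gs hs; ring.
exists (M + `|k| * N) => [|x]; first by rewrite addr_ge0 ?mulr_ge0.
rewrite (le_trans (ler_normB _ _)) // mulrDl lerD // normrM -mulrA.
by rewrite ler_wpM2l.
Qed.

End FunctionalArithmetic.

Section Action.
Variables (K : numFieldType) (X : normedModType K) (U : unital_soa X).
Implicit Types (a b c p q : U) (x y v w : X) (g h : X -> K).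

Lemma soa_ext a b : (forall x, a x = b x) -> a = b.
Proof. by move=> ab; do 2!apply: val_inj; apply/funext. Qed.

Lemma soaM a b x : (a * b) x = a (b x). Proof. by []. Qed.
Lemma soa1 x : (1 : U) x = x. Proof. by []. Qed.
Lemma soaD a b x : (a + b) x = a x + b x. Proof. by []. Qed.
Lemma soaN a x : (- a) x = - a x. Proof. by []. Qed.
Lemma soa0 x : (0 : U) x = 0. Proof. by []. Qed.
Lemma soaZ k a x : (k *: a) x = k *: a x. Proof. by []. Qed.
Definition soaE := (soaM, soa1, soaD, soaN, soa0, soaZ).

Lemma soa_neq0 a : a <> 0 -> exists x, a x <> 0.
Proof.
move=> a0; apply: contrapT => /forallNP H; apply: a0; apply: soa_ext => x.
by have /contrapT -> := H x.
Qed.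

Lemma rank_one_soa x g : bounded_functional g ->
  exists T : U, forall y, T y = g y *: x.
Proof.
move=> gb; have [gs [M M0 gM]] := gb.
have bl : (fun y => g y *: x) \in @bounded_linear K X.
  apply/bounded_linearP; split=> [k u v|]; first by rewrite gs scalerDl scalerA.
  exists (M * `|x|) => [|y]; first by rewrite mulr_ge0.
  by rewrite normrZ mulrAC ler_wpM2r.
have fr : finite_rank (Bop bl).
  have [g0|/existsNP[y gy]] := pselect (forall y, g y = 0).
    exists 0%N, (fun=> 0); apply/seteqP; split=> [_ [y _ <-]|_ [c _ <-]].
      by exists (fun=> 0) => //=; rewrite big_ord0 g0 scale0r.
    by exists 0 => //=; rewrite big_ord0 g0 scale0r.
  exists 1%N, (fun=> x); apply/seteqP; split=> [_ [z _ <-]|_ [c _ <-]].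
    by exists (fun=> g z) => //=; rewrite big_ord1.
  exists ((c ord0 / g y) *: y) => //=; rewrite big_ord1.
  by rewrite functionalZ // divfK //; apply/eqP.
have [_ _ /(_ _ fr) TU] := soa_standard U.
by exists (Soa TU).
Qed.

Hypothesis separating : forall v, v <> 0 ->
  exists2 g, bounded_functional g & g v = 1.

(** If a x and b y are nonzero, a rank one operator sends b y to x. *)
Lemma prime_soa : @prime_ring U.
Proof.
move=> a b ab; have [->|/eqP a0] := eqVneq a 0; first by left.
have [->|/eqP b0] := eqVneq b 0; first by right.
have [x ax] := soa_neq0 a0; have [y by0] := soa_neq0 b0.
have [g gb gy] := separating by0; have [T Tg] := rank_one_soa x gb.
case: ax; have := congr1 (fun c : U => c y) (ab T).
by rewrite !soaE Tg gy scale1r.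
Qed.

Lemma central_scale k : central (k *: (1 : U) : U).
Proof. by move=> a; apply: soa_ext => x; rewrite !soaE linearZ. Qed.

Lemma soa_scaleE k a : k *: a = (k *: (1 : U)) * a.
Proof. exact: soa_ext. Qed.

Hypothesis dimX : dim_ge X 2.

Section MinimalIdempotent.
Variables (x0 : X) (g0 : X -> K) (e : U).
Hypotheses (g0b : bounded_functional g0) (g0x0 : g0 x0 = 1).
Hypothesis eE : forall y, e y = g0 y *: x0.

Let g0Z k x : g0 (k *: x) = k * g0 x.
Proof. exact: functionalZ. Qed.

Lemma idempotent_rank_one : e * e = e.
Proof. by apply: soa_ext => y; rewrite soaM !eE g0Z g0x0 mulr1. Qed.

Lemma rank_one_neq0 : e <> 0.
Proof.
move=> e0; have := eE x0; rewrite e0 g0x0 scale1r soa0 => /esym x00.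
by have /eqP := g0x0; rewrite x00 functional0 // eq_sym oner_eq0.
Qed.

Lemma corner_rank_one (a : U) : exists2 z : U, central z & e * a * e = z * e.
Proof.
exists (g0 (a x0) *: (1 : U)); first exact: central_scale.
by apply: soa_ext => y; rewrite !soaE !eE linearZ g0Z scalerA mulrC.
Qed.

(** A central z commutes with e, so z x0 is a multiple of x0, and with the
    rank one operator T = g0 x, so z x = z (T x0) = T (z x0). *)
Lemma central_soaE (z : U) : central z -> z = g0 (z x0) *: (1 : U).
Proof.
move=> cz; apply: soa_ext => x; rewrite soaZ soa1.
have zx0 : z x0 = g0 (z x0) *: x0.
  have := congr1 (fun c : U => c x0) (cz e).
  by rewrite !soaM !eE g0x0 scale1r.
have [T Tx] := rank_one_soa x g0b.
have Tx0 : T x0 = x by rewrite Tx g0x0 scale1r.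
by rewrite -{1}Tx0 -soaM cz soaM {1}zx0 linearZ /= Tx0.
Qed.

(** As the dimension is at least two there is a nonzero w in the kernel of g0;
    v sends x0 to w and u sends w back to x0. *)
Lemma matrix_units_soa : exists u v : U,
  [/\ e * u = u, u * e = 0, v * e = v, e * v = 0 & u * v = e].
Proof.
have [w gw w0] : exists2 w, g0 w = 0 & w <> 0.
  have [v vfree] := dimX; apply: contrapT => nw.
  have ker y : y = g0 y *: x0.
    apply: contrapT => ny; apply: nw; exists (y - g0 y *: x0).
      by rewrite -scaleNr functionalD // g0Z g0x0 mulr1 subrr.
    by move/eqP; rewrite subr_eq0 => /eqP.
  pose i1 : 'I_2 := lift ord0 ord0.
  (* If every vector were a multiple of x0, g0 (v_1) v_0 - g0 (v_0) v_1 = 0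
     would be a linear relation. *)
  pose c (i : 'I_2) := if i == ord0 then g0 (v i1) else - g0 (v ord0).
  have c0 : \sum_i c i *: v i = 0.
    rewrite big_ord_recl big_ord1 /c /= -/i1 scaleNr.
    rewrite [X in _ - _ *: X]ker [X in _ *: X - _]ker.
    by rewrite !scalerA mulrC subrr.
  have v00 : g0 (v ord0) = 0.
    by have /eqP := vfree c c0 i1; rewrite /c /= oppr_eq0 => /eqP.
  have v0 : v ord0 = 0 by rewrite (ker (v ord0)) v00 scale0r.
  have := vfree (fun i => if i == ord0 then 1 else 0).
  rewrite big_ord_recl big_ord1 /= v0 scaler0 scale0r addr0 => /(_ erefl ord0).
  by move/eqP; rewrite oner_eq0.
have [h hb hw] := separating w0.
(* Subtracting h (x0) g0 makes the functional vanish at x0. *)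
have kb := bounded_functionalB (h x0) hb g0b.
have [u uE] := rank_one_soa x0 kb; have [v vE] := rank_one_soa w g0b.
exists u, v; split; apply: soa_ext => y; rewrite ?soaE ?eE ?uE ?vE.
- by rewrite g0Z g0x0 mulr1.
- by rewrite !(functionalZ _ _ hb) g0Z g0x0 mulr1 [_ * h _]mulrC subrr scale0r.
- by rewrite g0Z g0x0 mulr1.
- by rewrite g0Z gw mulr0 scale0r.
- by rewrite (functionalZ _ _ hb) g0Z hw gw !mulr0 mulr1 subr0.
Qed.

End MinimalIdempotent.

End Action.

(** * Strong continuity and finite support *)

Section FiniteSupport.
Variables (K : numFieldType) (X : normedModType K) (U : unital_soa X).
Variable V : zmodType.
Implicit Types (a b c p q x : U) (w : X) (W : seq X) (l : U -> V).

Definition kills W x := {in W, forall w, x w = 0}.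

(** The algebraic consequence of strong continuity from which the density
    argument can be run: it needs no topology on V, and passes through
    multiplications and brackets. *)
Definition finitely_supported l := exists W, forall x, kills W x -> l x = 0.

Lemma kills_cat W1 W2 x : kills (W1 ++ W2) x -> kills W1 x /\ kills W2 x.
Proof.
by move=> H; split=> w Ww; apply: H; rewrite mem_cat Ww ?orbT.
Qed.

(** If x kills W and c W, then both x c and c x kill W. *)
Lemma finitely_supported_bracket l c : {morph l : x y / x - y} ->
  finitely_supported l -> finitely_supported (fun x => l (lie_bracket x c)).
Proof.
move=> lB [W lW]; exists (W ++ [seq c w | w <- W]) => x /kills_cat[xW xcW].
rewrite /lie_bracket lB lW => [|w Ww]; last by rewrite soaM xcW ?map_f.
by rewrite lW ?subrr // => w Ww; rewrite soaM xW ?linear0.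
Qed.

Lemma finitely_supported_ad l s : {morph l : x y / x - y} ->
  finitely_supported l -> finitely_supported (fun x => l (ad s x)).
Proof.
move=> lB lf; elim: s => // c s IH.
apply: (@finitely_supported_bracket (fun x => l (ad s x))) => // x y.
by rewrite adB lB.
Qed.

Hypothesis separating : forall v : X, v <> 0 ->
  exists2 g, bounded_functional g & g v = 1.
Variables (x0 : X) (g0 : X -> K) (e : U).
Hypotheses (g0b : bounded_functional g0) (g0x0 : g0 x0 = 1).
Hypothesis eE : forall y, e y = g0 y *: x0.

(** P is a sum of operators p e q; the second clause encodes this without
    naming the summands. *)
Lemma exists_finite_rank_fixing W : exists P : U, {in W, forall w, P w = w} /\
  forall l, {morph l : x y / x + y} -> (forall p q, l (p * e * q) = 0) ->
  forall d, l (d * P) = 0.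
Proof.
elim: W => [|v W [P [PW lP]]].
  exists 0; split=> // l lD _ d; rewrite mulr0.
  by apply: (@addrI _ (l 0)); rewrite -lD !addr0.
have [v0|/eqP v0] := eqVneq (v - P v) 0.
  exists P; split=> // w; rewrite inE => /orP[/eqP ->|/PW //].
  by apply/eqP; rewrite eq_sym -subr_eq0 v0.
have [g gb gv] := separating v0.
have [p pE] := rank_one_soa U (v - P v) g0b.
have [q qE] := rank_one_soa U x0 gb.
(* The correction sends v - P v to itself and kills what P already fixes. *)
exists (P + p * e * (q * (1 - P))); split=> [w|l lD lpq d].
  rewrite !soaE inE => /orP[/eqP ->|Ww].
    by rewrite qE gv scale1r eE g0x0 scale1r pE g0x0 scale1r addrC subrK.
  by rewrite PW // subrr !linear0 addr0.
by rewrite mulrDr lD lP // add0r !mulrA -[d * p * e * q * _]mulrA lpq.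
Qed.

(** The strong density of the finite rank operators in the form in which it is
    used: x agrees on W with x P, which has finite rank. *)
Lemma finitely_supported_eq0 l : {morph l : x y / x + y} ->
  finitely_supported l -> (forall p q, l (p * e * q) = 0) -> forall x, l x = 0.
Proof.
move=> lD [W lW] lpq x.
have [P [PW /(_ _ lD lpq) lP]] := exists_finite_rank_fixing W.
have -> : x = x * P + x * (1 - P) by rewrite -mulrDr addrC subrK mulr1.
rewrite lD lP add0r lW // => w Ww.
by rewrite !soaE PW // subrr linear0.
Qed.

End FiniteSupport.

Section StrongContinuity.
Variables (K : numFieldType) (X : normedModType K) (U : unital_soa X).

(** The sets containing all operators that kill some finite set of vectors form
    a filter converging to 0. *)
Lemma nbhs0_relative_sot (B : set (relative_sot U)) :
  nbhs (0 : relative_sot U) B ->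
  exists W, forall x : U, kills W x -> B x.
Proof.
pose F : set_system U := [set B | exists W, forall x : U, kills W x -> B x].
have FF : Filter F.
  split; first by exists [::].
    move=> P Q [W1 P1] [W2 Q2]; exists (W1 ++ W2) => x /kills_cat[x1 x2].
    by split; [apply: P1|apply: Q2].
  by move=> P Q PQ [W PW]; exists W => x /PW; apply: PQ.
pose ev (x : U) : {ptws X -> X} := x : X -> X.
have evF : ev @ F --> ((0 : X -> X) : {ptws X -> X}).
  apply/pointwise_cvgP => t N /nbhs_singleton N0.
  by exists [:: t] => x xt; rewrite /= /ev xt ?mem_head.
case=> C; case; case=> O' O'o O'C C0 CB; case: O'o => O oO OO'.
have : (ev @ F) O.
  by apply: evF; apply: open_nbhs_nbhs; split=> //; move: C0; rewrite -O'C -OO'.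
case=> W WO; exists W => x /WO evO; apply: CB.
by rewrite -O'C -OO'.
Qed.

(** Operators killing W form a subspace, on which x |-> phi x w is bounded by 1,
    hence zero. *)
Lemma continuous_finitely_supported (phi : {linear U -> U}) (w : X) :
  continuous (phi : relative_sot U -> relative_sot U) ->
  exists W : seq X, forall x : U, kills W x -> phi x w = 0.
Proof.
move=> phic; pose N : set (relative_sot U) := [set y : U | `|(y : U) w| < 1].
have N0 : nbhs (0 : relative_sot U) N.
  pose f1 (x : relative_sot U) : strong_operator_topology X := soa_val (x : U).
  pose f2 (A : strong_operator_topology X) : {ptws X -> X} :=
    bop_fun (A : bop X).
  have c1 : continuous f1 by apply: initial_continuous.
  have c2 : continuous f2 by apply: initial_continuous.
  have B0 : nbhs (0 : X) [set y | `|y| < 1].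
    by apply/nbhs_normP; exists 1 => //= y; rewrite /= sub0r normrN.
  have c3 := @proj_continuous X (fun=> X) w (f2 (f1 0)).
  exact: (c1 0 _ (c2 (f1 0) _ (c3 _ B0))).
have : nbhs (0 : relative_sot U) (phi @^-1` N).
  by apply: phic; rewrite linear0.
move=> /nbhs0_relative_sot[W WN]; exists W => x xW.
have small (k : K) : `|k| * `|phi x w| < 1.
  have := WN (k *: x); rewrite /N /= linearZ soaZ normrZ; apply => v Wv.
  by rewrite soaZ xW // scaler0.
apply/eqP; rewrite -normr_eq0; apply/contraT => nz.
have := small (`|phi x w|^-1).
by rewrite normrV ?unitfE // normr_id mulVf ?ltxx.
Qed.

End StrongContinuity.

(** * Scalar multiplications plus central functionals *)

Section ScalarPlusFunctional.
Variables (K : numFieldType) (X : normedModType K) (U : unital_soa X).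
Hypothesis dimX : dim_ge X 2.
Hypothesis separating : forall v : X, v <> 0 ->
  exists2 g, bounded_functional g & g v = 1.
Variables (phi : {linear U -> U}) (m : nat).
Hypothesis phic : continuous (phi : relative_sot U -> relative_sot U).

(** The decomposition of the theorem for m + 2 arguments, with commutators
    written as iterated brackets so that the first two entries are visible. *)
Definition scalar_plus_functional := exists (lambda : K) (mu : {scalar U}),
  (forall A : U, phi A = lambda *: A + mu A *: (1 : U)) /\
  (forall (a b : U) (s : seq U), size s = m -> mu (ad s (lie_bracket a b)) = 0).

Lemma exists_minimal_idempotent : exists (x0 : X) (g0 : X -> K) (e : U),
  [/\ bounded_functional g0, g0 x0 = 1 & forall y, e y = g0 y *: x0].
Proof.
have [v vfree] := dimX.
have v0 : v ord0 <> 0.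
  move=> v0; have := vfree (fun i => if i == ord0 then 1 else 0).
  rewrite big_ord_recl big_ord1 /= v0 scaler0 scale0r addr0 => /(_ erefl ord0).
  by move/eqP; rewrite oner_eq0.
have [g gb gv] := separating v0; have [e eE] := rank_one_soa U (v ord0) gb.
by exists (v ord0), g, e.
Qed.

(** The central part d of phi is scalar valued and, by strong continuity,
    finitely supported. It kills the iterated commutators of zero products,
    hence those starting in the ideal generated by e, hence all of them by
    density. *)
Lemma centralizer_scalar_plus_functional (l : U) : central l ->
  (forall x, central (phi x - l * x)) ->
  (forall a b (s : seq U), size s = m -> a * b = 0 ->
     phi (ad s (lie_bracket a b)) = l * ad s (lie_bracket a b)) ->
  scalar_plus_functional.
Proof.
move=> cl cphi phi_ad.
have [x0 [g0 [e [g0b g0x0 eE]]]] := exists_minimal_idempotent.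
pose lambda := g0 (l x0).
have lE : l = lambda *: (1 : U) by exact: (central_soaE g0b g0x0 eE cl).
pose d x := phi x - l * x.
pose f x := g0 (d x x0).
have dE x : d x = f x *: (1 : U) by exact: (central_soaE g0b g0x0 eE (cphi x)).
have dlin k x y : d (k *: x + y) = k *: d x + d y.
  rewrite /d linearP lE -!soa_scaleE scalerDr scalerBr opprD addrACA.
  by rewrite !scalerA [lambda * k]mulrC.
have flin : scalar f.
  by move=> k x y; rewrite /f dlin soaD soaZ functionalD // functionalZ.
have dB : {morph d : x y / x - y}.
  move=> x y; rewrite /d raddfB mulrBr !opprB addrACA [RHS]addrACA.
  by rewrite [- phi y + _]addrC.
have dfin : finitely_supported d.
  have [W HW] := continuous_finitely_supported x0 phic.
  exists (x0 :: W) => x xW; rewrite dE /f /d !soaE HW; last first.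
    by move=> w Ww; apply: xW; rewrite inE Ww orbT.
  by rewrite xW ?mem_head // linear0 oppr0 addr0 functional0 // scale0r.
have eeq := idempotent_rank_one g0b g0x0 eE.
have d_ad a b s : size s = m -> d (ad s (lie_bracket a b)) = 0.
  move=> sm; pose t x := d (ad s (lie_bracket x b)).
  have tB : {morph t : x y / x - y}.
    by move=> x y; rewrite /t lie_bracketBl adB dB.
  have tD : {morph t : x y / x + y} by exact: morphBD.
  have tfin : finitely_supported t.
    exact: (finitely_supported_ad (b :: s) dB dfin).
  apply: (finitely_supported_eq0 separating g0b g0x0 eE tD tfin) => p q.
  apply: (@ideal_bracket_eq0 _ e _ (fun x => d (ad s x)) eeq
    (corner_rank_one g0b eE)).
  - by move=> x y; rewrite adB dB.
  - by move=> x y xy; rewrite /d phi_ad ?subrr.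
pose mu : {scalar U} := HB.pack f (GRing.isLinear.Build K U K *%R f flin).
exists lambda, mu; split=> [A|a b s sm].
  by rewrite /= -dE /d lE -soa_scaleE addrC subrK.
by rewrite /= /f d_ad // soa0 functional0.
Qed.

End ScalarPlusFunctional.

(** * The equivalence *)

Section Equivalence.
Variables (K : numFieldType) (X : normedModType K) (U : unital_soa X).
Hypothesis dimX : dim_ge X 2.
Hypothesis separating : forall v : X, v <> 0 ->
  exists2 g, bounded_functional g & g v = 1.
Variables (phi : {linear U -> U}) (m : nat).
Hypothesis phic : continuous (phi : relative_sot U -> relative_sot U).

Lemma cond_Tl_scalar_plus_functional :
  cond_Tl m.+2 phi -> scalar_plus_functional phi m.
Proof.
move=> Tl; have [x0 [g0 [e [g0b g0x0 eE]]]] :=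
  exists_minimal_idempotent U dimX separating.
have phi_ad (a b : U) s : size s = m -> a * b = 0 ->
    phi (ad s (lie_bracket a b)) = ad s (lie_bracket (phi a) b).
  by move=> sm ab; have := Tl a b (Tuple (introT eqP sm)) ab.
have [u [v [eu ue ve ev uv]]] := matrix_units_soa separating dimX g0b g0x0 eE.
have phiZ (z a : U) : central z -> phi (z * a) = z * phi a.
  by move=> /(central_soaE g0b g0x0 eE) ->; rewrite -!soa_scaleE linearZ.
have [l cl lx] := centralizer_zero_product (prime_soa separating)
  (idempotent_rank_one g0b g0x0 eE) (rank_one_neq0 g0b g0x0 eE)
  (corner_rank_one g0b eE) ue ve ev uv (raddfB phi) phiZ phi_ad.
apply: (centralizer_scalar_plus_functional dimX separating phic cl lx).
move=> a b s sm ab.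
have pE : phi a = l * a + (phi a - l * a) by rewrite addrC subrK.
by rewrite phi_ad // pE (lie_bracket_centrall _ _ cl (lx a)) ad_centralZ.
Qed.

Lemma cond_Tr_scalar_plus_functional :
  cond_Tr m.+2 phi -> scalar_plus_functional phi m.
Proof.
move=> Tr; have [x0 [g0 [e [g0b g0x0 eE]]]] :=
  exists_minimal_idempotent U dimX separating.
have phi_ad (a b : U) s : size s = m -> a * b = 0 ->
    phi (ad s (lie_bracket a b)) = ad s (lie_bracket a (phi b)).
  by move=> sm ab; have := Tr a b (Tuple (introT eqP sm)) ab.
have [u [v [eu ue ve ev uv]]] := matrix_units_soa separating dimX g0b g0x0 eE.
have phiZ (z a : U) : central z -> phi (z * a) = z * phi a.
  by move=> /(central_soaE g0b g0x0 eE) ->; rewrite -!soa_scaleE linearZ.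
have [l cl lx] := centralizer_zero_product_r (prime_soa separating)
  (idempotent_rank_one g0b g0x0 eE) (rank_one_neq0 g0b g0x0 eE)
  (corner_rank_one g0b eE) eu ue ev uv (raddfB phi) phiZ phi_ad.
apply: (centralizer_scalar_plus_functional dimX separating phic cl lx).
move=> a b s sm ab.
have pE : phi b = l * b + (phi b - l * b) by rewrite addrC subrK.
by rewrite phi_ad // pE (lie_bracket_centralr _ _ cl (lx b)) ad_centralZ.
Qed.

Lemma scalar_plus_functional_ad : scalar_plus_functional phi m ->
  forall (a b : U) s, size s = m ->
    phi (ad s (lie_bracket a b)) = ad s (lie_bracket (phi a) b) /\
    phi (ad s (lie_bracket a b)) = ad s (lie_bracket a (phi b)).
Proof.
move=> [k [mu [phiE mu_ad]]] a b s sm.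
have phiE' A : phi A = (k *: (1 : U)) * A + mu A *: (1 : U).
  by rewrite -soa_scaleE.
rewrite !phiE' mu_ad // scale0r addr0.
rewrite lie_bracket_centrall ?lie_bracket_centralr ?ad_centralZ //;
  exact: central_scale.
Qed.

End Equivalence.

Theorem proposition5p4 (R : realType) (X : completeNormedModType R[i])
    (hX : dim_ge X 2) (U : unital_soa X) (n : nat) (hn : (2 <= n)%N)
    (phi : {linear U -> U})
    (hphi : continuous (phi : relative_sot U -> relative_sot U)) :
  [<-> lie_centralizer n phi;
       cond_N n phi;
       cond_Nl n phi;
       cond_Nr n phi;
       cond_T n phi;
       cond_Tl n phi;
       cond_Tr n phi;
       exists (lambda : R[i]) (mu : {scalar U}),
         (forall A : U, phi A = lambda *: A + mu A *: (1 : U)) /\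
         (forall A : n.-tuple U, mu (lie_comm A) = 0)].
Proof.
case: n hn => [//|[//|m]] _.
have separating := @exists_bounded_functional R X.
have TlS := cond_Tl_scalar_plus_functional (m := m) hX separating hphi.
have TrS := cond_Tr_scalar_plus_functional (m := m) hX separating hphi.
have SI : scalar_plus_functional phi m -> lie_centralizer m.+2 phi.
  move=> S a s; case/tupleP: s => b s.
  by have [] := scalar_plus_functional_ad S a b (size_tuple s).
have ITl : lie_centralizer m.+2 phi -> cond_Tl m.+2 phi.
  by move=> I a b s _; have := I a [tuple of b :: s].
have SN : scalar_plus_functional phi m -> cond_N m.+2 phi.
  move=> S; split=> a b s _;
    by have [] := scalar_plus_functional_ad S a b (size_tuple s).
have ST : scalar_plus_functional phi m -> cond_T m.+2 phi.
  move=> S; split=> a b s _;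
    by have [] := scalar_plus_functional_ad S a b (size_tuple s).
have prod0 (a b : U) (s : seq U) :
    a * b = 0 -> \prod_(c <- [:: a, b & s]) c = 0.
  by move=> ab; rewrite !big_cons mulrA ab mul0r.
have NlTl : cond_Nl m.+2 phi -> cond_Tl m.+2 phi.
  by move=> Nl a b s ab; apply: Nl; apply: prod0.
have NrTr : cond_Nr m.+2 phi -> cond_Tr m.+2 phi.
  by move=> Nr a b s ab; apply: Nr; apply: prod0.
tfae.
- by move=> /ITl /TlS /SN.
- by case.
- by move=> /NlTl /TlS /SN[].
- by move=> /NrTr /TrS /ST.
- by case.
- by move=> /TlS /ST[].
- move=> /TrS [k [mu [phiE mu0]]]; exists k, mu; split=> // A.
  case/tupleP: A => a A; case/tupleP: A => b s.
  by apply: mu0; apply: size_tuple.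
- move=> [k [mu [phiE mu0]]]; apply: SI; exists k, mu; split=> // a b s sm.
  by have := mu0 [tuple of a :: b :: Tuple (introT eqP sm)].
Qed.
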